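(* Let $d$ be a constant, let $\beta>0$ be a fixed constant, and let $\mathcal{P}$ be a set of stochastic points in $\mathbb{R}^d$ in the existential uncertainty model with $p_v\ge\beta$ for all $v\in\mathcal{P}$. For $\varepsilon,\tau>0$, let $\mu=\min\{\varepsilon,\tau\}$. Then there is an $(\varepsilon,\tau)$-quant-kernel of $\mathcal{P}$ of size $O\!\left(\frac{1}{\mu^{(d-1)/2}}\log\frac{1}{\mu}\right)$ which satisfies the subset constraint.
   Context: Existential model: each $v\in\mathcal{P}$ is present in a random realization $P\sim\mathcal{P}$ independently with probability $p_v$. For a finite point set $P$, $f(P,u)=\max_{p\in P}\langle u,p\rangle$ (with $f(\emptyset,u)=0$) and $\omega(P,u)=f(P,u)+f(P,-u)$. A set $\mathcal{S}$ of stochastic points is an $(\varepsilon,\tau)$-quant-kernel of $\mathcal{P}$ if for all directions $u$ and all $x\ge 0$: $\Pr_{P\sim\mathcal{P}}[\omega(P,u)\le(1-\varepsilon)x]-\tau\le\Pr_{S\sim\mathcal{S}}[\omega(S,u)\le x]\le\Pr_{P\sim\mathcal{P}}[\omega(P,u)\le(1+\varepsilon)x]+\tau$. The subset constraint requires that $\mathcal{S}$ be a subset of $\mathcal{P}$ with each chosen point keeping its original existence probability (independently). *)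

(* Defs.v *)
From HB Require Import structures.
From mathcomp Require Import all_boot all_order all_algebra finmap.
From mathcomp Require Import reals exp.

Set Implicit Arguments.
Unset Strict Implicit.
Unset Printing Implicit Defensive.
Import Order.TTheory GRing.Theory Num.Theory.
Local Open Scope fset_scope.
Local Open Scope ring_scope.

(* The values of [sp_prob] outside [sp_pts] are irrelevant. *)
Record stoch_points (R : realType) (d : nat) := StochPoints {
  sp_pts : {fset 'rV[R]_d};
  sp_prob : 'rV[R]_d -> R;
  sp_probP : forall v, v \in sp_pts -> 0 <= sp_prob v <= 1
}.

Section QuantKernel.
Variables (R : realType) (d : nat).
Implicit Types (A : {fset 'rV[R]_d}) (X Y : stoch_points R d).

Definition inner (u v : 'rV[R]_d) : R := \sum_(i < d) u 0 i * v 0 i.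

(* The maximum of <u, v> over v in A, with value 0 on the empty set; in the
   nonempty case the first element seeds the iterated maximum, so that no
   default value interferes when all the inner products are negative. *)
Definition support_fun A (u : 'rV[R]_d) : R :=
  if enum_fset A is a :: s then \big[Num.max/inner u a]_(v <- s) inner u v
  else 0.

Definition width A (u : 'rV[R]_d) : R := support_fun A u + support_fun A (- u).

(* Pr_{A ~ X}[E A] when every v in X is present independently with its own
   probability: the realization A has mass
   prod_{v in A} p_v * prod_{v in X \ A} (1 - p_v). *)
Definition Prob X (E : pred {fset 'rV[R]_d}) : R :=
  \sum_(A <- fpowerset (sp_pts X) | E A)
    (\prod_(v <- A) sp_prob X v) *
    (\prod_(v <- sp_pts X `\` A) (1 - sp_prob X v)).

Definition direction (u : 'rV[R]_d) : Prop := inner u u = 1.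

Definition quant_kernel (eps tau : R) X Y : Prop :=
  forall (u : 'rV[R]_d) (x : R), direction u -> 0 <= x ->
    Prob X (fun A => width A u <= (1 - eps) * x) - tau
      <= Prob Y (fun A => width A u <= x) /\
    Prob Y (fun A => width A u <= x)
      <= Prob X (fun A => width A u <= (1 + eps) * x) + tau.

Definition subset_constraint X Y : Prop :=
  sp_pts Y `<=` sp_pts X /\
  (forall v, v \in sp_pts Y -> sp_prob Y v = sp_prob X v).

End QuantKernel.

(* Main.v *)
Require Import Defs.
From HB Require Import structures.
From mathcomp Require Import all_boot all_order all_algebra finmap.
From mathcomp Require Import reals sequences exp.
From mathcomp Require Import ring lra.
Import Order.TTheory GRing.Theory Num.Theory.
Local Open Scope fset_scope.
Local Open Scope ring_scope.

Set Implicit Arguments.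
Unset Strict Implicit.
Unset Printing Implicit Defensive.

(** Peel off P successive kernels E_1, ..., E_L, where E_i approximates the
    width of what E_1, ..., E_(i-1) left over, up to a factor 1 + mu in every
    direction, and let S be their union.  For a direction u let (a_i, b_i) be
    the extreme pair of E_i.  These L pairs are disjoint, so each of them
    misses a point with probability at most (1 - beta^2)^L <= mu when
    L ~ log(1/mu) / beta^2; otherwise some pair is entirely present, and then
    it almost spans the slab of the points outside S, so that removing these
    points shrinks the width by a factor at most 1 + mu.  Intersecting the
    realization of P with S couples the two distributions.

    A kernel of size O(mu^(-(d-1)/2)) comes from a linear change of coordinates
    putting the points in [-1, 1]^d with the widths bounded below, followed by
    taking the nearest neighbours of a sqrt(mu)-net of the boundary of
    [-2, 2]^d. *)

(** * Expectations over independent random subsets *)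

Section Expectation.
Variables (R : realType) (K : choiceType) (p : K -> R).
Implicit Types (X Y Z A B T : {fset K}) (f g : {fset K} -> R).

Definition mass X A : R := (\prod_(v <- A) p v) * \prod_(v <- X `\` A) (1 - p v).

Definition expect X f : R := \sum_(A <- fpowerset X) mass X A * f A.

Lemma expect0 f : expect fset0 f = f fset0.
Proof.
by rewrite /expect fpowerset0 big_seq_fset1 /mass fsetD0 !big_seq_fset0 !mul1r.
Qed.

Lemma eq_expect X f g :
  (forall A, A `<=` X -> f A = g A) -> expect X f = expect X g.
Proof.
move=> fg; rewrite /expect [LHS]big_seq [RHS]big_seq; apply: eq_bigr => A.
by rewrite fpowersetE => /fg ->.
Qed.

Lemma expectD X f g : expect X (fun A => f A + g A) = expect X f + expect X g.
Proof. by rewrite -big_split; apply: eq_bigr => A _; rewrite mulrDr. Qed.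

Lemma expectZ X c f : expect X (fun A => c * f A) = c * expect X f.
Proof. by rewrite /expect mulr_sumr; apply: eq_bigr => A _; rewrite mulrCA. Qed.

Lemma expectU1 x X f : x \notin X ->
  expect (x |` X) f =
  p x * expect X (fun A => f (x |` A)) + (1 - p x) * expect X f.
Proof.
move=> xX; have xNA A : A \in fpowerset X -> x \notin A.
  by rewrite fpowersetE => /fsubsetP/(_ x) AX; apply: contra xX.
rewrite {1}/expect (big_fsetID _ (fun A => x \in A)) /=; congr (_ + _).
- have -> : [fset A | A in fpowerset (x |` X) & x \in A] =
            [fset x |` A | A in fpowerset X].
    apply/fsetP => A; rewrite !inE /=; apply/andP/imfsetP => /= [[]|[B]].
      rewrite fpowersetE => AX xA; exists (A `\ x); last by rewrite fsetD1K.
      by rewrite fpowersetE fsubDset.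
    by rewrite fpowersetE => BX ->; rewrite fpowersetE fsetUS // fset1U1.
  rewrite big_imfset /=; last first.
    by move=> A B /xNA xA /xNA xB AB; rewrite -(fsetU1K xA) AB fsetU1K.
  rewrite /expect mulr_sumr [LHS]big_seq [RHS]big_seq.
  apply: eq_bigr => A AX; rewrite /mass big_fsetU1 ?xNA //=.
  have -> : (x |` X) `\` (x |` A) = X `\` A.
    apply/fsetP => y; rewrite !inE; case: eqP => [->|] //=.
    by rewrite (negPf xX) andbF.
  by rewrite !mulrA.
- have -> : [fset A | A in fpowerset (x |` X) & x \notin A] = fpowerset X.
    apply/fsetP => A; rewrite !inE /= !fpowersetE.
    apply/andP/idP => [[AX xA]|AX]; last first.
      split; first exact: fsubset_trans AX (fsubsetU1 _ _).
      by apply: xNA; rewrite fpowersetE.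
    apply/fsubsetP => y yA; move/fsubsetP: AX => /(_ y yA); rewrite !inE.
    by case: eqP yA => // -> xA'; rewrite xA' in xA.
  rewrite /expect mulr_sumr [LHS]big_seq [RHS]big_seq.
  apply: eq_bigr => A AX; rewrite /mass.
  have -> : (x |` X) `\` A = x |` (X `\` A).
    apply/fsetP => y; rewrite !inE; case: eqP => [->|] //=.
    by rewrite xNA.
  rewrite big_fsetU1 /=; last by rewrite !inE (negPf xX) andbF.
  by rewrite mulrCA !mulrA.
Qed.

(** Independence in the form of Fubini's theorem, by conditioning on the points of [Y] one at a
    time. *)
Lemma expectU Y Z f : [disjoint Y & Z] ->
  expect (Y `|` Z) f = expect Y (fun A => expect Z (fun B => f (A `|` B))).
Proof.
elim/finSet_rect: Y f => Y IH f YZ.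
have [->|[x xY]] := fset_0Vmem Y.
  by rewrite fset0U expect0; apply: eq_expect => B _; rewrite fset0U.
have YxZ : [disjoint Y `\ x & Z] by apply: fdisjointWl YZ; exact: fsubsetDl.
have xYx : x \notin Y `\ x by rewrite !inE eqxx.
have xYZ : x \notin (Y `\ x) `|` Z.
  by rewrite !inE eqxx /=; exact: (fdisjointP YZ).
rewrite -{1 2}(fsetD1K xY) -fsetUA !expectU1 // !IH ?fproperD1 //.
congr (_ * _ + _); apply: eq_expect => A _.
by apply: eq_expect => B _; rewrite fsetUA.
Qed.

Lemma expect_cst X c : expect X (fun=> c) = c.
Proof.
elim/finSet_rect: X => X IH; have [->|[x xX]] := fset_0Vmem X.
  by rewrite expect0.
have xXx : x \notin X `\ x by rewrite !inE eqxx.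
rewrite -{1}(fsetD1K xX) expectU1 // !IH ?fproperD1 //.
by rewrite -mulrDl addrCA subrr addr0 mul1r.
Qed.

Lemma fdisjointXD X Y : [disjoint X & Y `\` X].
Proof. by apply/fdisjointP => y yX; rewrite !inE yX. Qed.

Lemma fsetUDr X Y : X `<=` Y -> X `|` (Y `\` X) = Y.
Proof.
move=> XY; apply/fsetP => y; rewrite !inE.
by case yX: (y \in X); rewrite //= (fsubsetP XY).
Qed.

(** Points outside [S] integrate out to 1. This is the coupling: a realization of the subset is a
    realization of the whole set intersected with [S]. *)
Lemma expect_restr X S f : S `<=` X ->
  expect S f = expect X (fun A => f (A `&` S)).
Proof.
move=> SX; have dSX := fdisjointXD S X.
rewrite -{1}(fsetUDr SX) expectU // ; apply: eq_expect => A AS.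
rewrite -[LHS](expect_cst (X `\` S)); apply: eq_expect => B BX; congr (f _).
apply/fsetP => y; rewrite !inE; case yA: (y \in A) => /=.
  by rewrite (fsubsetP AS).
apply/esym/negbTE/negP => /andP[yB yS].
by have := fsubsetP BX y yB; rewrite !inE yS.
Qed.

Lemma le_expect X f g : (forall v, v \in X -> 0 <= p v <= 1) ->
  (forall A, A `<=` X -> f A <= g A) -> expect X f <= expect X g.
Proof.
move=> p01 fg; rewrite /expect [leLHS]big_seq [leRHS]big_seq.
apply: ler_sum => A; rewrite fpowersetE => AX; apply: ler_wpM2l (fg _ AX).
apply: mulr_ge0; rewrite big_seq; apply: prodr_ge0 => v.
  by move=> /(fsubsetP AX)/p01/andP[].
by rewrite inE => /andP[_ /p01/andP[_ ?]]; rewrite subr_ge0.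
Qed.

Lemma expect_all_present X : expect X (fun A => (X `<=` A)%:R) = \prod_(v <- X) p v.
Proof.
rewrite /expect (big_fsetD1 X) /=; last by rewrite fpowersetE.
rewrite fsubset_refl mulr1 /mass fsetDv big_seq_fset0 mulr1.
rewrite [X in _ + X]big_seq [X in _ + X]big1 ?addr0 //.
move=> A; rewrite !inE fpowersetE => /andP[AX sAX].
by rewrite [X `<=` A]negbTE ?mulr0 //; apply: contra AX => XA; rewrite eqEfsubset sAX.
Qed.

(** Disjoint sets are present independently: split [X] into the first [T], which is incomplete with
    probability at most [1 - q], and [X \ T], which contains all the later sets. *)
Lemma expect_none_present X (Ts : seq {fset K}) (q : R) :
  (forall v, v \in X -> 0 <= p v <= 1) ->
  (forall T, T \in Ts -> T `<=` X /\ q <= \prod_(v <- T) p v) ->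
  q <= 1 -> pairwise (fun T T' => [disjoint T & T']) Ts ->
  expect X (fun A => (all (fun T => ~~ (T `<=` A)) Ts)%:R) <= (1 - q) ^+ size Ts.
Proof.
move=> p01 TsP q1; elim: Ts X p01 TsP => [|T Ts IH] X p01 TsP /=.
  by rewrite expect_cst.
move=> /andP[/allP dT dTs].
have [TX qT] := TsP T (mem_head _ _).
have dXT := fdisjointXD T X.
have XTX : X `\` T `<=` X by exact: fsubsetDl.
rewrite -(fsetUDr TX) expectU //.
have -> : expect T (fun A => expect (X `\` T) (fun B =>
    (~~ (T `<=` A `|` B) && all (fun T => ~~ (T `<=` A `|` B)) Ts)%:R)) =
  expect T (fun A => expect (X `\` T) (fun B =>
    (all (fun T => ~~ (T `<=` B)) Ts)%:R) * (1 - (T `<=` A)%:R)).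
  apply: eq_expect => A AT; rewrite mulrC -expectZ; apply: eq_expect => B BX.
  have -> : (T `<=` A `|` B) = (T `<=` A).
    apply/idP/idP => [TAB|TA]; last exact: fsubset_trans TA (fsubsetUl _ _).
    apply/fsubsetP => y yT; move/fsubsetP: TAB => /(_ y yT); rewrite !inE.
    by case/orP => // /(fsubsetP BX); rewrite !inE yT.
  have -> : all (fun T => ~~ (T `<=` A `|` B)) Ts = all (fun T => ~~ (T `<=` B)) Ts.
    apply: eq_in_all => T' T'Ts; congr (~~ _).
    apply/idP/idP => [TAB|TA]; last exact: fsubset_trans TA (fsubsetUr _ _).
    apply/fsubsetP => y yT; move/fsubsetP: TAB => /(_ y yT); rewrite !inE.
    case/orP => // /(fsubsetP AT) yT'.
    by have := fdisjointP (dT _ T'Ts) y yT'; rewrite yT.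
  by case: (T `<=` A); rewrite /= ?subrr ?mul0r ?subr0 ?mul1r.
rewrite expectZ (eq_expect (X := T) (g := fun A => 1 + (-1) * (T `<=` A)%:R)); last first.
  by move=> A _; rewrite mulN1r.
rewrite expectD expect_cst expectZ expect_all_present mulN1r exprS mulrC.
have T1 : \prod_(v <- T) p v <= 1.
  rewrite big_seq; apply: prodr_ile1 => v vT.
  exact: p01 (fsubsetP TX v vT).
apply: ler_pM; rewrite ?subr_ge0 ?lerD2l ?lerN2//.
  rewrite -(expect_cst (X `\` T) 0); apply: le_expect => // v /(fsubsetP XTX); exact: p01.
apply: IH => //; first by move=> v /(fsubsetP XTX); exact: p01.
move=> T' T'Ts; have [T'X qT'] := TsP T' (mem_behead (T'Ts : T' \in behead (T :: Ts))).
split=> //; apply/fsubsetP => y yT'; rewrite !inE (fsubsetP T'X) // andbT.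
by apply/negP => yT; have := fdisjointP (dT _ T'Ts) y yT; rewrite yT'.
Qed.

End Expectation.

(** * Directional width and peeling of successive kernels *)

Section Width.
Variables (R : realType) (d : nat).
Implicit Types (A B E S X : {fset 'rV[R]_d}) (u v a b : 'rV[R]_d).

Lemma innerE u v : inner u v = (u *m v^T) 0 0.
Proof. by rewrite mxE; apply: eq_bigr => i _; rewrite mxE. Qed.

Lemma innerNl u v : inner (- u) v = - inner u v.
Proof. by rewrite !innerE mulNmx mxE. Qed.

Lemma innerBr u v w : inner u (v - w) = inner u v - inner u w.
Proof. by rewrite !innerE linearB /= mulmxBr !mxE. Qed.

Lemma le_support_fun A u v : v \in A -> inner u v <= support_fun A u.
Proof.
rewrite /support_fun -[v \in A]/(v \in enum_fset A).
case: (enum_fset A) => [//|a s]; rewrite in_cons => /orP[/eqP ->|vs].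
  exact: bigmax_ge_id.
exact: le_bigmax_seq.
Qed.

Lemma support_fun_attained A u : A != fset0 ->
  exists2 v, v \in A & support_fun A u = inner u v.
Proof.
rewrite /support_fun -cardfs_gt0 => A0.
suff [v vA ->] : exists2 v, v \in enum_fset A &
    (if enum_fset A is a :: s then \big[Num.max/inner u a]_(v <- s) inner u v
     else 0) = inner u v by exists v.
move: A0; case: (enum_fset A) => [//|a s] _.
rewrite big_seq; apply: (big_ind (fun y => exists2 v, v \in a :: s & y = inner u v)).
- by exists a; rewrite ?mem_head.
- by move=> x y [v vs ->] [w ws ->]; case: leP => _; [exists w|exists v].
- by move=> v vs; exists v; rewrite // in_cons vs orbT.
Qed.

Lemma width_fset0 u : width fset0 u = 0.
Proof. by rewrite /width /support_fun addr0. Qed.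

Lemma le_width A u a b : a \in A -> b \in A ->
  inner u a - inner u b <= width A u.
Proof.
by move=> aA bA; rewrite -innerNl lerD // le_support_fun.
Qed.

Lemma width_attained A u : A != fset0 ->
  exists a b, [/\ a \in A, b \in A & width A u = inner u a - inner u b].
Proof.
move=> A0; have [a aA Ea] := support_fun_attained u A0.
have [b bA Eb] := support_fun_attained (- u) A0.
by exists a, b; rewrite /width Ea Eb innerNl.
Qed.

Lemma width_ge0 A u : 0 <= width A u.
Proof.
have [->|[a aA]] := fset_0Vmem A; first by rewrite width_fset0.
by apply: le_trans (le_width u aA aA); rewrite subrr.
Qed.

Lemma widthS A B u : A `<=` B -> width A u <= width B u.
Proof.
have [-> _|A0 AB] := eqVneq A fset0; first by rewrite width_fset0 width_ge0.
have [a [b [aA bA ->]]] := width_attained u A0.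
by apply: le_width; apply: (fsubsetP AB).
Qed.

Lemma width_le A u r : 0 <= r ->
  (forall a b, a \in A -> b \in A -> inner u a - inner u b <= r) ->
  width A u <= r.
Proof.
move=> r0 Ar; have [->|A0] := eqVneq A fset0; first by rewrite width_fset0.
by have [a [b [aA bA ->]]] := width_attained u A0; exact: Ar.
Qed.

(** The pair itself is among the compared points, so that the bound also covers a leftover point
    against [ab.1] or [ab.2]. *)
Definition spanning_pair (eps : R) X S u (ab : 'rV[R]_d * 'rV[R]_d) :=
  [/\ ab.1 \in S, ab.2 \in S &
    forall p q, p \in [fset ab.1; ab.2] `|` (X `\` S) ->
      q \in [fset ab.1; ab.2] `|` (X `\` S) ->
      inner u p - inner u q <= (1 + eps) * (inner u ab.1 - inner u ab.2)].

(** Each extreme point of [A] lies in [S] or is leftover. In a mixed case, with p in [S] and q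
    leftover, write p - q = (p - b) + (a - q) - (a - b): the terms contribute at most W + (1 +
    eps)(a - b) - (a - b), where a - b is at most W. *)
Lemma spanning_pair_width eps X S u ab A : 0 <= eps ->
  spanning_pair eps X S u ab -> A `<=` X -> [fset ab.1; ab.2] `<=` A ->
  width A u <= (1 + eps) * width (A `&` S) u.
Proof.
case: ab => a b /= eps0 [/= aS bS abP] AX; rewrite fsubUset !fsub1set => /andP[aA bA].
have aAS : a \in A `&` S by rewrite inE aA.
have bAS : b \in A `&` S by rewrite inE bA.
have hab := le_width u aAS bAS; set W := width (A `&` S) u in hab *.
have W0 : 0 <= W := width_ge0 _ _.
have aT : a \in [fset a; b] `|` (X `\` S) by rewrite !inE eqxx.
have bT : b \in [fset a; b] `|` (X `\` S) by rewrite !inE eqxx orbT.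
have TP p : p \in A -> p \in A `&` S \/ p \in [fset a; b] `|` (X `\` S).
  move=> pA; rewrite !inE pA (fsubsetP AX _ pA) /=.
  by case: (p \in S); [left|right; rewrite orbT].
apply: width_le => [|p q /TP[pS|pT] /TP[qS|qT]]; first nra.
- by have := le_width u pS qS; rewrite -/W; nra.
- by have := le_width u pS bAS; have := abP _ _ aT qT; rewrite -/W; nra.
- by have := le_width u aAS qS; have := abP _ _ pT bT; rewrite -/W; nra.
- by have := abP _ _ pT qT; nra.
Qed.

(** The set [S] is chosen before the direction; only the pairs depend on [u]. The extreme pair of
    the first kernel spans all of [X], later pairs come from peeling [X \ E] and so avoid [E]. The
    alternative [S = X] occurs when the points run out before [L] rounds. *)
Lemma peeling (eps : R) (k : nat) :
  (forall X, X != fset0 -> exists E, [/\ E `<=` X, E != fset0, (#|` E| <= k)%N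
     & forall u, width X u <= (1 + eps) * width E u]) ->
  forall (L : nat) X, exists S, [/\ S `<=` X, (#|` S| <= L * k)%N &
    S = X \/ forall u, exists abs : seq ('rV[R]_d * 'rV[R]_d),
      [/\ size abs = L, forall ab, ab \in abs -> spanning_pair eps X S u ab &
        pairwise (fun ab ab' => [disjoint [fset ab.1; ab.2] & [fset ab'.1; ab'.2]]) abs]].
Proof.
move=> kerP; elim=> [|L IH] X.
  by exists fset0; split; [exact: fsub0set|rewrite cardfs0|right=> u; exists [::]].
have [X0|X0] := eqVneq X fset0.
  by exists fset0; rewrite X0 cardfs0; split => //; left.
have [E [EX E0 Ek Ew]] := kerP X X0; have [S [SX SL SP]] := IH (X `\` E).
have XS : (X `\` E) `\` S = X `\` (E `|` S) by rewrite fsetDDl.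
exists (E `|` S); split.
- by rewrite fsubUset EX (fsubset_trans SX) ?fsubsetDl.
- rewrite mulSn (leq_trans _ (leq_add Ek SL)) // -cardfsUI; exact: leq_addr.
case: SP => [SX'|SP].
  left; rewrite SX'; apply/fsetP => y; rewrite !inE.
  by case yE: (y \in E); rewrite //= (fsubsetP EX).
right=> u; have [abs [absL absP absD]] := SP u.
have [a [b [aE bE Eab]]] := width_attained u E0.
exists ((a, b) :: abs); split => /=; first by rewrite absL.
- move=> ab; rewrite in_cons => /orP[/eqP ->|/absP[abS1 abS2]].
    split=> [||p q pT qT] /=; rewrite ?inE ?aE ?bE //.
    rewrite -Eab; apply: le_trans (Ew u).
    have TX : [fset a; b] `|` (X `\` (E `|` S)) `<=` X.
      by rewrite !fsubUset !fsub1set !(fsubsetP EX) // fsubsetDl.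
    by apply: le_width; apply: (fsubsetP TX).
  by rewrite XS => abP; split; rewrite ?inE ?abS1 ?abS2 ?orbT.
- rewrite absD andbT; apply/allP => ab /absP[abS1 abS2 _].
  have ESd y : y \in S -> y \notin E.
    by move/(fsubsetP SX); rewrite inE => /andP[].
  apply/fdisjointP => y; rewrite !inE => yab.
  have yE : y \in E by case/orP: yab => /eqP ->.
  by apply/negP => /orP[] /eqP yE'; move: yE; rewrite yE' (negPf (ESd _ _)).
Qed.
End Width.

(** * Small width kernels: normalization to a box, then nets on the boundary of a cube *)

Section Kernel.
Variable R : realType.

(** Cramer's rule: [C i j] times the determinant is an entry of [B *m \adj F], and the cofactors
    along row [j] do not see the replaced row. *)
Lemma det_rowsub_replace N r (B : 'M[R]_(N, r)) (f g : 'I_r -> 'I_N)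
    (C : 'M[R]_(N, r)) (i : 'I_N) (j : 'I_r) :
  B = C *m rowsub f B -> g j = i -> (forall k, k != j -> g k = f k) ->
  \det (rowsub g B) = C i j * \det (rowsub f B).
Proof.
move=> BE gj gk; set F := rowsub f B.
have -> : C i j * \det F = (B *m \adj F) i j.
  by rewrite {1}BE -/F -mulmxA mul_mx_adj mul_mx_scalar mxE mulrC.
rewrite (expand_det_row _ j) mxE; apply: eq_bigr => k _.
rewrite !mxE gj; congr (_ * _); rewrite /cofactor; congr (_ * \det _).
by apply/matrixP => a b; rewrite !mxE gk // eq_sym neq_lift.
Qed.

(* Rows of maximal determinant: by Cramer's rule all coordinates with respect
   to them are at most 1 in absolute value. *)
Lemma barycentric_spanner N r (B : 'M[R]_(N, r)) : row_full B ->
  exists (f : 'I_r -> 'I_N) (C : 'M[R]_(N, r)),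
    B = C *m rowsub f B /\ forall i j, `|C i j| <= 1.
Proof.
move=> Bfull; pose D (f : {ffun 'I_r -> 'I_N}) := `|\det (rowsub f B)|.
have D0 : 0 < D (fullrankfun Bfull).
  by rewrite normr_gt0 -unitfE -unitmxE fullrowsub_unit.
have [f fmax] : exists f, forall g, D g <= D f.
  pose f := [arg max_(f > fullrankfun Bfull) D f]%O.
  by exists f => g; rewrite /f; case: arg_maxP => // h _; apply.
have fU : 0 < D f := lt_le_trans D0 (fmax _).
have funit : rowsub f B \in unitmx by rewrite unitmxE unitfE -normr_gt0.
pose C := B *m invmx (rowsub f B).
have BE : B = C *m rowsub f B by rewrite mulmxKV.
exists f, C; split=> // i j.
pose g : {ffun 'I_r -> 'I_N} := [ffun k => if k == j then i else f k].
have := fmax g; rewrite /D (det_rowsub_replace BE (i := i) (j := j)).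
- by rewrite normrM => CD; rewrite -(ler_pM2r fU) mul1r.
- by rewrite ffunE eqxx.
- by move=> k kj; rewrite ffunE (negPf kj).
Qed.

(** Taking a barycentric spanner among the differences [pts i - pts i0] makes each coordinate of [w]
    a difference of two inner products with input points, hence at most the width in direction [u].
    Errors proportional to the coordinates of [w] are thus relative errors, however flat the point
    set. *)
Lemma box_coordinates N d (pts : 'I_N -> 'rV[R]_d) (i0 : 'I_N) :
  exists c : 'I_N -> 'rV[R]_d, (forall i j, `|c i 0 j| <= 1) /\
  forall u, exists w : 'rV[R]_d,
    (forall i, inner u (pts i) - inner u (pts i0) = inner w (c i)) /\
    forall j, exists i, w 0 j = inner u (pts i) - inner u (pts i0).
Proof.
pose A := \matrix_i (pts i - pts i0).
have Ai i : row i A = pts i - pts i0 by rewrite rowK.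
have [f [C [BE C1]]] := barycentric_spanner (col_base_full A).
have AE : A = C *m rowsub f A.
  rewrite -{1}(mulmx_base A) {1}BE -mulmxA; congr (_ *m _).
  by rewrite mul_rowsub_mx mulmx_base.
(* The points may span a smaller subspace; [I] pads the coordinates with zeros up to dimension
   [d]. *)
pose I : 'M[R]_(\rank A, d) := pid_mx (\rank A).
have IT : I *m I^T = 1%:M by rewrite tr_pid_mx pid_mx_id ?rank_leq_col // pid_mx_1.
have IE m (M : 'M[R]_(m, \rank A)) a j :
    (M *m I) a j = if insub (val j) is Some k then M a k else 0.
  rewrite mxE; case: insubP => [k _ kj|jr].
    rewrite (bigD1 k) //= !mxE kj eqxx -kj ltn_ord mulr1 big1 ?addr0 // => l lk.
    by rewrite mxE -kj (inj_eq val_inj) (negPf lk) mulr0.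
  apply: big1 => l _; rewrite mxE; case: eqP => [lj|]; rewrite ?mulr0 //.
  by move: jr; rewrite /= -lj ltn_ord.
exists (fun i => row i C *m I); split=> [i j|u].
  by rewrite IE; case: insubP => [k _ _|_]; rewrite ?normr0 ?mxE.
exists (u *m (rowsub f A)^T *m I); split=> [i|j].
  rewrite -innerBr -Ai !innerE trmx_mul !mulmxA -(mulmxA _ I) IT mulmx1.
  by rewrite -mulmxA -trmx_mul -row_mul -AE.
rewrite IE; case: insubP => [k _ _|_]; last by exists i0; rewrite subrr.
exists (f k); rewrite -innerBr -Ai !mxE; apply: eq_bigr => l _.
by rewrite !mxE.
Qed.

(** [T j] is the time at which the ray reaches the facet that coordinate [j] moves towards; the
    least such time is the exit time. Starting in the unit box, coordinate [j] travels a distance at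
    least 1 to get there. *)
Lemma cube_exit n (s w : 'rV[R]_n) : (forall j, `|s 0 j| <= 1) -> w != 0 ->
  exists (t : R) j, [/\ 0 < t, 1 <= t * `|w 0 j|,
    (s + t *: w) 0 j = 2 \/ (s + t *: w) 0 j = -2 &
    forall k, `|(s + t *: w) 0 k| <= 2].
Proof.
move=> s1 /rV0Pn[j0 wj0].
pose T j := (2 - Num.sg (w 0 j) * s 0 j) / `|w 0 j|.
pose j := [arg min_(j < j0 | w 0 j != 0) T j]%O.
have [wj jmin] : w 0 j != 0 /\ forall k, w 0 k != 0 -> T j <= T k.
  by rewrite /j; case: arg_minP.
have sgs k : -1 <= Num.sg (w 0 k) * s 0 k <= 1.
  rewrite -ler_norml normrM normr_sg.
  by have := s1 k; case: (w 0 k != 0); rewrite ?mul1r ?mul0r.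
have awj : 0 < `|w 0 j| by rewrite normr_gt0.
have Tw : T j * `|w 0 j| = 2 - Num.sg (w 0 j) * s 0 j by rewrite divfK ?gt_eqF.
have Tj0 : 0 < T j by rewrite divr_gt0 //; have := sgs j; lra.
exists (T j), j; split=> //.
- by rewrite Tw; have := sgs j; lra.
- rewrite !mxE; move: Tw; case: (ltgtP (w 0 j) 0) wj => // wj _ Tw.
    by right; move: Tw; rewrite ltr0_norm // ltr0_sg //; lra.
  by left; move: Tw; rewrite gtr0_norm // gtr0_sg //; lra.
- move=> k; rewrite !mxE; have [->|wk] := eqVneq (w 0 k) 0.
    by rewrite mulr0 addr0 (le_trans (s1 k)) // ler1n.
  have awk : 0 < `|w 0 k| by rewrite normr_gt0.
  have := jmin k wk; rewrite ler_pdivlMr // => Tk.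
  have Tk0 : 0 <= T j * `|w 0 k| by rewrite mulr_ge0 // ltW.
  have := sgs k; rewrite ler_norml; move: Tk Tk0.
  case: (ltgtP (w 0 k) 0) wk => // wk _.
    by rewrite ltr0_norm // ltr0_sg //; lra.
  by rewrite gtr0_norm // gtr0_sg //; lra.
Qed.

(** A facet, given by a coordinate and a sign, and a grid position in the [n] other coordinates: the
    net size grows with exponent [n], one below the dimension. *)
Definition cube_net_index n m := ('I_n.+1 * bool * {ffun 'I_n -> 'I_m})%type.

Definition cube_net n m (g : cube_net_index n m) : 'rV[R]_n.+1 :=
  \row_j (if unlift g.1.1 j is Some k then (g.2 k)%:R * (4 / m%:R) - 2
          else if g.1.2 then 2 else -2).

Lemma grid_approx m (x : R) : `|x| <= 2 ->
  exists k : 'I_m.+1, `|k%:R * (4 / m.+1%:R) - 2 - x| <= 4 / m.+1%:R.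
Proof.
rewrite ler_norml => /andP[x0 x2].
have m0 : 0 < m.+1%:R :> R by rewrite ltr0n.
pose h : R := 4 / m.+1%:R; have h0 : 0 < h by rewrite divr_gt0.
have hm : h * m.+1%:R = 4 by rewrite divfK ?gt_eqF.
pose r := (x + 2) / h; have r0 : 0 <= r by rewrite divr_ge0 ?(ltW h0) //; lra.
have rh : r * h = x + 2 by rewrite divfK ?gt_eqF.
have [tr|tr] := ltnP (Num.truncn r) m.+1.
  exists (Ordinal tr) => /=; rewrite -/h ler_norml.
  have := truncn_le r; rewrite r0 => t1.
  have t2 : r < (Num.truncn r).+1%:R by rewrite -truncn_le_nat.
  move: t2; rewrite -addn1 natrD => t2.
  by apply/andP; split; nra.
(* Here x = 2: its index would be [m.+1], out of range, but the last grid point is only one step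
   away. *)
exists ord_max => /=; rewrite -/h ler_norml.
have t1 : m.+1%:R <= r by rewrite (le_trans _ (eqbRL (truncn_le r) r0))// ler_nat.
move: hm t1; rewrite -addn1 natrD => hm t1.
by apply/andP; split; nra.
Qed.

Lemma cube_net_approx n m (x : 'rV[R]_n.+1) j :
  x 0 j = 2 \/ x 0 j = -2 -> (forall k, `|x 0 k| <= 2) ->
  exists g : cube_net_index n m.+1,
    forall k, `|cube_net g 0 k - x 0 k| <= 4 / m.+1%:R.
Proof.
move=> xj x2.
have /fin_all_exists[g gP] k := grid_approx m (x2 (lift j k)).
exists (j, x 0 j == 2, finfun g) => k; rewrite mxE /=.
case: unliftP => [k' ->|->]; first by rewrite ffunE.
have N2 : (-2 == 2 :> R) = false by apply/eqP; lra.
by case: xj => ->; rewrite ?eqxx ?N2 subrr normr0 divr_ge0.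
Qed.

(** With y = s + t w + e and z = q - s, the left side is |s - y|^2 - |q - y|^2, which is nonnegative
    when q is a nearest neighbour of y. The terms quadratic in t cancel. *)
Lemma sqnorm_id n (w z e : 'rV[R]_n) t :
  inner (t *: w + e) (t *: w + e) - inner (z - (t *: w + e)) (z - (t *: w + e)) =
  2 * t * inner w z + inner e e - inner (z - e) (z - e).
Proof.
rewrite /inner mulr_sumr -sumrB -big_split -sumrB /=.
by apply: eq_bigr => i _; rewrite !mxE; ring.
Qed.

Lemma inner_ge0 n (z : 'rV[R]_n) : 0 <= inner z z.
Proof. by apply: sumr_ge0 => i _; rewrite -expr2 sqr_ge0. Qed.

Lemma inner_le n (e : 'rV[R]_n) h : (forall k, `|e 0 k| <= h) ->
  inner e e <= n%:R * h ^+ 2.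
Proof.
move=> eh; rewrite mulr_natl -[n in _ *+ n]card_ord -sumr_const.
apply: ler_sum => i _; rewrite -expr2 -real_normK ?num_real //.
by rewrite lerXn2r ?nnegrE // (le_trans _ (eh i)).
Qed.

(* Nearest neighbours of the net points.  If [s + t w] is the exit point and
   [y] a net point at distance e, the nearest neighbour q of y satisfies
   |q - y| <= |s - y|, which expands to <w, s - q> <= |e|^2 / 2t: the error is
   quadratic in the mesh, hence the exponent (d - 1) / 2. *)
Lemma net_kernel N n m (c : 'I_N -> 'rV[R]_n.+1) (i0 : 'I_N) :
  (forall i j, `|c i 0 j| <= 1) ->
  exists J : {set 'I_N}, [/\ (#|J| <= n.+1 * 2 * m.+1 ^ n)%N, J != set0 &
    forall (w : 'rV[R]_n.+1) (W : R), (forall j, `|w 0 j| <= W) -> forall i,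
    exists2 k, k \in J &
      inner w (c i) - inner w (c k) <= n.+1%:R * (4 / m.+1%:R) ^+ 2 / 2 * W].
Proof.
move=> c1; pose D (g : cube_net_index n m.+1) k :=
  inner (c k - cube_net g) (c k - cube_net g).
pose phi g := [arg min_(k < i0) D g k]%O.
have phiP g k : D g (phi g) <= D g k.
  by rewrite /phi; case: arg_minP => // ? _; apply.
have g0 : cube_net_index n m.+1 := (ord0, true, [ffun=> ord0]).
exists [set phi g | g in [set: cube_net_index n m.+1]]; split.
- apply: leq_trans (leq_imset_card _ _) _.
  by rewrite cardsT !card_prod card_ffun !card_ord card_bool.
- by apply/set0Pn; exists (phi g0); apply: imset_f.
move=> w W wW i.
have W0 : 0 <= W by apply: le_trans (wW ord0).
(* For [w = 0] there is no ray to follow, and any selected point has zero error. *)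
have [w0|w0] := eqVneq w 0.
  exists (phi g0); first exact: imset_f.
  rewrite -innerBr w0 innerE mul0mx mxE mulr_ge0 // divr_ge0 // mulr_ge0 //.
  exact: sqr_ge0.
have [t [j [t0 tw xj x2]]] := cube_exit (c1 i) w0.
have [g gP] := cube_net_approx m xj x2.
exists (phi g); first exact: imset_f.
set e := cube_net g - (c i + t *: w); set z := c (phi g) - c i.
have e2 : inner e e <= n.+1%:R * (4 / m.+1%:R) ^+ 2.
  by apply: inner_le => k; rewrite mxE [X in _ + X]mxE; exact: gP.
have := phiP g i; rewrite /D.
have -> : c (phi g) - cube_net g = z - (t *: w + e).
  by rewrite /z /e; apply/matrixP => a b; rewrite !mxE; ring.
have -> : c i - cube_net g = - (t *: w + e).
  by rewrite /e; apply/matrixP => a b; rewrite !mxE; ring.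
have -> (v : 'rV[R]_n.+1) : inner (- v) (- v) = inner v v.
  by apply: eq_bigr => k _; rewrite mxE mulrNN.
move=> near; have sqE := sqnorm_id w z e t; have ze0 := inner_ge0 (z - e).
move: sqE; rewrite [inner w z]innerBr => sqE.
set a := inner w (c i) in sqE *; set b := inner w (c (phi g)) in sqE *.
set Q := n.+1%:R * _ ^+ 2 in e2 *.
have Q0 : 0 <= Q by apply: le_trans (inner_ge0 e) e2.
have tab : 2 * t * (a - b) <= Q by lra.
(* This trades the factor 1/t of the error bound for [W]. *)
have tW : 1 <= t * W by apply: le_trans tw _; rewrite ler_pM2l // wW.
rewrite -(ler_pM2l (x := 2 * t)) ?mulr_gt0 //; apply: le_trans tab _.
have -> : 2 * t * (Q / 2 * W) = Q * (t * W) by field.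
by rewrite ler_peMr.
Qed.

(** Each end of the slab loses at most [eps / 4] of the width, and (1 + eps)(1 - eps/2) is at least
    1 for [eps <= 1]. The constant 32 makes the net error 8 (d+1) / (m+1)^2 at most [eps / 4]. *)
Lemma kernel_exists d m (eps : R) (X : {fset 'rV[R]_d.+1}) :
  0 < eps <= 1 -> 32 * d.+1%:R <= eps * m.+1%:R ^+ 2 -> X != fset0 ->
  exists E : {fset 'rV[R]_d.+1},
    [/\ E `<=` X, E != fset0, (#|` E| <= d.+1 * 2 * m.+1 ^ d)%N &
      forall u, width X u <= (1 + eps) * width E u].
Proof.
move=> /andP[eps0 eps1] mP; rewrite -cardfs_gt0 => X0.
pose N := #|` X|; pose pts (i : 'I_N) : 'rV[R]_d.+1 := nth 0 (enum_fset X) i.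
have ptsX i : pts i \in X by apply: mem_nth.
have ptsP x : x \in X -> exists i, x = pts i.
  move=> xX; have iX : (index x (enum_fset X) < N)%N by rewrite index_mem.
  by exists (Ordinal iX); rewrite /pts nth_index.
have [c [c1 cP]] := box_coordinates pts (Ordinal X0).
have [J [JN J0 JP]] := net_kernel m (Ordinal X0) c1.
exists [fset pts k | k in J]; split.
- by apply/fsubsetP => _ /imfsetP[k _ ->].
- case/set0Pn: J0 => k kJ; apply/fset0Pn; exists (pts k).
  by apply/imfsetP; exists k.
- apply: leq_trans (leq_imfset_card _ _ _) _; apply: leq_trans JN.
  by rewrite cardE.
move=> u; have [w [wP wj]] := cP u; set E := [fset _ | _ in _].
have JE k : k \in J -> pts k \in E by move=> kJ; apply/imfsetP; exists k.
have [|a [b [/ptsP[i ->] /ptsP[j ->] Wab]]] := @width_attained _ _ X u.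
  by rewrite -cardfs_gt0.
set W := width X u in Wab *.
have wW l : `|w 0 l| <= W.
  have [k ->] := wj l; rewrite ler_norml lerNl opprB.
  by rewrite !le_width.
have nwW l : `|(- w) 0 l| <= W by rewrite mxE normrN.
(* The maximum is approximated along [w] and the minimum along [- w]. *)
have [k kJ kP] := JP w W wW i; have [l lJ lP] := JP (- w) W nwW j.
have := le_width u (JE _ kJ) (JE _ lJ); move: kP lP; rewrite !innerNl -!wP.
set V := width E u; set Q := _ * _ ^+ 2 / 2.
have m0 : 0 < m.+1%:R :> R by rewrite ltr0n.
have QE : Q <= eps / 4.
  rewrite /Q expr_div_n mulrA ler_pdivrMr // ler_pdivrMr ?exprn_gt0 //.
  by move: mP; set M := _ ^+ 2; lra.
have W0 : 0 <= W := width_ge0 _ _.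
have QW : Q * W <= eps / 4 * W by rewrite ler_wpM2r.
move=> h1 h2 h3; have hV : W * (1 - eps / 2) <= V by lra.
apply: le_trans (_ : (1 + eps) * (W * (1 - eps / 2)) <= _); last first.
  by rewrite ler_wpM2l //; lra.
have : 0 <= W * (eps * (1 - eps)) by rewrite !mulr_ge0 ?subr_ge0 // ltW.
lra.
Qed.

End Kernel.

(** * From spanning pairs to quant-kernels by coupling *)

Section Assembly.
Variables (R : realType) (d : nat).
Implicit Types (X Y : stoch_points R d) (S : {fset 'rV[R]_d}).

Lemma ProbE X (E : pred {fset 'rV[R]_d}) :
  Prob X E = expect (sp_prob X) (sp_pts X) (fun A => (E A)%:R).
Proof.
rewrite /Prob big_mkcond; apply: eq_bigr => A _.
by case: ifP; rewrite ?mulr1 ?mulr0.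
Qed.

Definition restrict X S (SX : S `<=` sp_pts X) : stoch_points R d :=
  StochPoints (fun v vS => sp_probP (fsubsetP SX v vS)).

(** Under the coupling, the lower bound is monotonicity of width alone; the failure event [F] only
    enters the upper bound, where its probability is absorbed by [tau]. *)
Lemma quant_kernel_restrict (mu eps tau : R) X S (SX : S `<=` sp_pts X) :
  0 <= mu -> mu <= eps -> mu <= tau ->
  (forall u, exists F : pred {fset 'rV[R]_d},
     Prob X F <= mu /\
     forall A, A `<=` sp_pts X -> ~~ F A ->
       width A u <= (1 + mu) * width (A `&` S) u) ->
  quant_kernel eps tau X (restrict SX).
Proof.
move=> mu0 mueps mutau SP u x _ x0.
have -> : Prob (restrict SX) (fun A => width A u <= x) =
          Prob X (fun A => width (A `&` S) u <= x).
  by rewrite !ProbE /= (expect_restr _ _ SX).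
split.
  rewrite lerBlDr -[leLHS]addr0; apply: lerD; last exact: le_trans mutau.
  rewrite !ProbE; apply: le_expect => [v|A AX]; first exact: sp_probP.
  rewrite ler_nat; case: (leP (width A u)) => //= wA.
  suff -> : width (A `&` S) u <= x by [].
  apply: le_trans (widthS u (fsubsetIl A S)) _; apply: le_trans wA _.
  by rewrite ler_piMl // gerBl (le_trans mu0).
have [F [FP FA]] := SP u.
apply: le_trans (lerD (lexx _) (le_trans FP mutau)).
rewrite !ProbE -expectD; apply: le_expect => [v|A AX]; first exact: sp_probP.
rewrite -natrD ler_nat; case: (leP _ x) => //= wA.
case FAE: (F A); first by rewrite addn1.
suff -> : width A u <= (1 + eps) * x by [].
apply: le_trans (FA A AX _) _; first by rewrite FAE.
apply: ler_pM => //; rewrite ?width_ge0 ?lerD2l //.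
by rewrite addr_ge0.
Qed.

Lemma pairs_absent (b mu : R) X u S abs : 0 <= b -> b <= 1 ->
  (forall v, v \in sp_pts X -> b <= sp_prob X v) -> S `<=` sp_pts X ->
  (forall ab, ab \in abs -> spanning_pair mu (sp_pts X) S u ab) ->
  pairwise (fun ab ab' => [disjoint [fset ab.1; ab.2] & [fset ab'.1; ab'.2]]) abs ->
  Prob X (fun A => all (fun ab => ~~ ([fset ab.1; ab.2] `<=` A)) abs)
    <= (1 - b ^+ 2) ^+ size abs.
Proof.
move=> b0 b1 bP SX absP absD; rewrite ProbE.
pose T (ab : 'rV[R]_d * 'rV[R]_d) := [fset ab.1; ab.2].
rewrite -(size_map T) (eq_expect _ (g := fun A =>
  (all (fun B : {fset _} => ~~ (B `<=` A)) [seq T ab | ab <- abs])%:R)); last first.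
  by move=> A _; rewrite all_map.
apply: expect_none_present => [v| || ]; first exact: sp_probP.
- move=> _ /mapP[[x y] /absP[/= xS yS _] ->]; split.
    by rewrite fsubUset !fsub1set !(fsubsetP SX).
  have bx := bP x (fsubsetP SX _ xS); have by_ := bP y (fsubsetP SX _ yS).
  (* A degenerate pair is a single point, present with probability at least [b], which is at least
     [b ^+ 2]. *)
  rewrite /T /=; have [->|xy] := eqVneq x y.
    rewrite fsetUid big_seq_fset1 (le_trans _ by_) // expr2.
    by rewrite -[leRHS]mulr1 ler_wpM2l.
  by rewrite big_fsetU1 ?inE //= big_seq_fset1 expr2 ler_pM.
- by rewrite exprn_ile1.
- by rewrite pairwise_map.
Qed.

End Assembly.

(** * Choice of the number of rounds and of the mesh, and the final size bound *)

Lemma exp_decay_le (R : realType) (q mu : R) (L : nat) :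
  0 < q <= 1 -> 0 < mu -> ln (1 / mu) / q <= L%:R -> (1 - q) ^+ L <= mu.
Proof.
move=> /andP[q0 q1] mu0; rewrite ler_pdivrMr // div1r lnV ?posrE // => Lq.
apply: le_trans (_ : expR (- q) ^+ L <= _).
  by rewrite lerXn2r ?nnegrE ?subr_ge0 ?expR_ge0 // expR_ge1Dx.
rewrite -expRM_natr -[leRHS]lnK ?posrE // ler_expR; lra.
Qed.

(** The unit lost in rounding up is absorbed into [c * x]; this serves both for the number of rounds
    and for the mesh. *)
Lemma natr_truncnS_le (R : realType) (x c : R) : 0 <= x -> 1 <= c * x ->
  (Num.truncn x).+1%:R <= (c + 1) * x.
Proof.
move=> x0 cx; rewrite -natr1; have := truncn_le x; rewrite x0; lra.
Qed.

Lemma ltr_truncnS (R : realType) (x : R) : x < (Num.truncn x).+1%:R.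
Proof. by rewrite -truncn_le_nat. Qed.

Theorem mainTheorem11 (R : realType) (d : nat) (beta : R) (hbeta : 0 < beta) :
  exists C : R, 0 < C /\
    forall (P : stoch_points R d),
      (forall v, v \in sp_pts P -> beta <= sp_prob P v) ->
      forall eps tau : R, 0 < eps -> 0 < tau ->
      let mu := Num.min eps tau in
      exists S : stoch_points R d,
        [/\ quant_kernel eps tau P S,
            subset_constraint P S
          & mu <= 1 / 2 ->
            #|` sp_pts S|%:R
              <= C * (1 / (mu `^ ((d%:R - 1) / 2)) * ln (1 / mu))].
Proof.
case: d => [|d].
  (* Dimension 0 has no unit vectors, so the empty set is a kernel. *)
  exists 1; split=> // P _ eps tau eps0 tau0 mu.
  have mu0 : 0 < mu by rewrite lt_min eps0.
  exists (restrict (fsub0set (sp_pts P))); split=> // [u x|mu1].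
    by rewrite /direction /inner big_ord0 => /esym/eqP; rewrite oner_eq0.
  rewrite /= mul1r mulr_ge0 ?divr_ge0 ?powR_ge0 //.
  by rewrite ln_ge0 // ler_pdivlMr // mul1r; lra.
(* [beta] may exceed 1 when [P] is empty; capping it keeps [1 - b ^+ 2] in [0, 1]. *)
pose b := Num.min beta 1.
have b0 : 0 < b by rewrite lt_min hbeta ltr01.
have b1 : b <= 1 by rewrite ge_min lexx orbT.
pose q := b ^+ 2; have q0 : 0 < q by rewrite exprn_gt0.
have q1 : q <= 1 by rewrite exprn_ile1 // ltW.
have ln2 : 0 < ln 2 :> R by rewrite ln_gt0 // ltr1n.
pose D : R := 32 * d.+1%:R; have D1 : 1 <= D.
  by rewrite /D -natrM ler1n muln_gt0.
have D0 : 0 <= D by lra.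
(* With this [c], [c * (ln (1 / nu) / q)] is [ln (1 / nu) / ln 2], at least 1 since
   [nu <= 1 / 2]. *)
pose c : R := q / ln 2; have c0 : 0 < c by rewrite divr_gt0.
pose C : R := (c + 1) / q * (d.+1 * 2)%:R * (2 * Num.sqrt D) ^+ d.
have C0 : 0 < C.
  rewrite /C !mulr_gt0 ?exprn_gt0 ?mulr_gt0 ?sqrtr_gt0 ?invr_gt0 ?ltr0n //; lra.
exists C; split=> // P betaP eps tau eps0 tau0 mu.
(* The kernel property is claimed for every [mu], while the construction needs a parameter at most
   1; in the range of the size bound, [nu = mu]. *)
pose nu := Num.min mu (1 / 2).
have mu0 : 0 < mu by rewrite lt_min eps0.
have nu0 : 0 < nu by rewrite lt_min mu0 divr_gt0.
have nu2 : nu <= 1 / 2 by rewrite ge_min lexx orbT.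
have numu : nu <= mu by rewrite ge_min lexx.
pose m := Num.truncn (Num.sqrt (D / nu)).
pose L := Num.truncn (ln (1 / nu) / q).
have mP : D <= nu * m.+1%:R ^+ 2.
  rewrite mulrC -ler_pdivrMr // -[leLHS]sqr_sqrtr ?divr_ge0 ?(ltW nu0) //.
  by rewrite lerXn2r ?nnegrE ?sqrtr_ge0 // ltW // ltr_truncnS.
have nu01 : 0 < nu <= 1 by rewrite nu0 /=; lra.
have [S [SX SL SP]] := peeling (fun X => kernel_exists nu01 mP) L.+1 (sp_pts P).
exists (restrict SX); split=> //.
- apply: (@quant_kernel_restrict _ _ nu).
  + exact: ltW.
  + by apply: le_trans numu _; rewrite ge_min lexx.
  + by apply: le_trans numu _; rewrite ge_min lexx orbT.
  move=> u; case: SP => [SE|SP].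
    (* All points were kept, so nothing can fail. *)
    exists pred0; split; first by rewrite /Prob big_pred0_eq ltW.
    move=> A AX _; rewrite SE (fsetIidPl AX) ler_peMl ?width_ge0 //; lra.
  have [abs [absL absP absD]] := SP u.
  exists (fun A => all (fun ab => ~~ ([fset ab.1; ab.2] `<=` A)) abs); split.
    apply: le_trans (pairs_absent (ltW b0) b1 _ SX absP absD) _.
      by move=> v vP; rewrite ge_min betaP.
    rewrite absL; apply: exp_decay_le; rewrite -/q ?q0 // ltW //.
    exact: ltr_truncnS.
  move=> A AX /allPn[ab abI]; rewrite negbK => abA.
  exact: spanning_pair_width (ltW nu0) (absP _ abI) AX abA.
- move=> mu2 /=; have nuE : nu = mu by rewrite /nu min_l.
  have -> : (d.+1%:R - 1) / 2 = 2^-1 * d%:R :> R by rewrite -natr1 addrK mulrC.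
  rewrite powRrM powR12_sqrt ?(ltW mu0) // powR_mulrn ?sqrtr_ge0 //.
  have lnu : ln 2 <= ln (1 / nu).
    by rewrite ler_ln ?posrE ?divr_gt0 // ler_pdivlMr //; lra.
  have LE : L.+1%:R <= (c + 1) * (ln (1 / nu) / q).
    apply: natr_truncnS_le; first by rewrite divr_ge0 ?ltW // (lt_le_trans ln2).
    have -> : c * (ln (1 / nu) / q) = ln (1 / nu) / ln 2.
      by rewrite /c; field; rewrite !gt_eqF.
    by rewrite ler_pdivlMr // [leLHS]mul1r.
  (* The factor 2 is the rounding loss with constant 1, as [D / nu] is at least 1. *)
  have mE : m.+1%:R <= 2 * Num.sqrt D / Num.sqrt nu.
    have -> : 2 * Num.sqrt D / Num.sqrt nu = (1 + 1) * Num.sqrt (D / nu).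
      by rewrite (sqrtrM _ D0) sqrtrV ?ltW // mulrA.
    apply: natr_truncnS_le; rewrite ?sqrtr_ge0 // mul1r -[leLHS]sqrtr1.
    by rewrite ler_wsqrtr // ler_pdivlMr // mul1r; lra.
  apply: le_trans (_ : (L.+1 * (d.+1 * 2 * m.+1 ^ d))%:R <= _).
    by rewrite ler_nat.
  rewrite natrM [X in _ * X]natrM natrX.
  apply: le_trans (_ : (c + 1) * (ln (1 / nu) / q) *
    ((d.+1 * 2)%:R * (2 * Num.sqrt D / Num.sqrt nu) ^+ d) <= _).
    apply: ler_pM => //; first by rewrite mulr_ge0 ?exprn_ge0.
    by rewrite ler_wpM2l // lerXn2r ?nnegrE // (le_trans _ mE).
  rewrite -nuE expr_div_n /C.
  have : 0 < Num.sqrt nu ^+ d by rewrite exprn_gt0 // sqrtr_gt0.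
  move: (Num.sqrt nu ^+ d) ((2 * _) ^+ d) (ln (1 / nu)) => y x l y0.
  by rewrite le_eqVlt; apply/predU1P; left; field; rewrite !gt_eqF.
Qed.
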